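(* Let $\kappa$ be a regular cardinal and $\mu>\kappa$ a cardinal with $\operatorname{cf}(\mu)<\kappa$. If there exists a $(\kappa,\mu)$-Jensen matrix (over some $x\in\mathcal{H}(\chi)$, for some sufficiently large $\chi$), then $\Box^{***}_{\kappa,\mu}$ holds.
   Context: $\mathcal{H}(\chi)$ is the set of sets hereditarily of cardinality $<\chi$; $[X]^{<\kappa}=\{Y\subseteq X:|Y|<\kappa\}$. $\Box^{***}_{\kappa,\mu}$ (for $\kappa$ regular, $\mu>\kappa$): there are a sequence $(C_\alpha)_{\alpha<\mu^+}$ and a club $D\subseteq\mu^+$ such that for every $\alpha\in D$ with $\operatorname{cf}(\alpha)\geq\kappa$: $C_\alpha\subseteq\alpha$ is unbounded in $\alpha$, and every $x\in[C_\alpha]^{<\kappa}$ is a subset of some $C_{\alpha'}$ with $\alpha'<\alpha$ and $|C_{\alpha'}|<\kappa$. Let $\mu^*=\operatorname{cf}(\mu)$. A $(\kappa,\mu)$-Jensen matrix over $x\in\mathcal{H}(\chi)$ is a sequence $(M_{\alpha,\beta})_{\alpha<\mu^+,\beta<\mu^*}$ such that: (j1) each $M_{\alpha,\beta}$ is an elementary submodel of $(\mathcal{H}(\chi),\in)$, $x\in M_{\alpha,\beta}$, $\kappa+1\subseteq M_{\alpha,\beta}$ and $|M_{\alpha,\beta}|<\mu$; (j2) for each $\alpha<\mu^+$, $(M_{\alpha,\beta})_{\beta<\mu^*}$ is increasing; (j3) if $\alpha<\mu^+$ and $\operatorname{cf}(\alpha)\geq\kappa$, then there is $\beta^*<\mu^*$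 such that for every $\beta$ with $\beta^*\leq\beta<\mu^*$, $[M_{\alpha,\beta}]^{<\kappa}\cap M_{\alpha,\beta}$ is cofinal in $([M_{\alpha,\beta}]^{<\kappa},\subseteq)$; (j4) letting $M_\alpha=\bigcup_{\beta<\mu^*}M_{\alpha,\beta}$, the sequence $(M_\alpha)_{\alpha<\mu^+}$ is continuously increasing and $\mu^+\subseteq\bigcup_{\alpha<\mu^+}M_\alpha$. *)

(* Defs.v *)
From HB Require Import structures.
From Stdlib Require Import Relation_Operators.
From mathcomp Require Import all_boot.
From mathcomp Require Import boolp classical_sets functions cardinality.

Set Implicit Arguments.
Unset Strict Implicit.
Unset Printing Implicit Defensive.

Local Open Scope classical_set_scope.
Local Open Scope card_scope.

(* [zfset] is Aczel's type of well-founded trees modulo bisimulation: the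
   tree [Sup f] denotes the set of the denotations of the [f a].  Quotienting
   (an element is a bisimulation class) makes set equality Leibniz equality.
   The lemmas below show that (zfset, vmem) satisfies the axioms of ZFC, with
   separation and replacement for arbitrary Rocq predicates and functions. *)

Inductive tree := Sup (A : Type) (f : A -> tree).

Fixpoint bisim (s t : tree) : Prop :=
  match s, t with
  | Sup A f, Sup B g =>
      (forall a, exists b, bisim (f a) (g b)) /\
      (forall b, exists a, bisim (f a) (g b))
  end.

Definition zfset := {c : tree -> Prop | exists t, c = bisim t}.

Definition denote (t : tree) : zfset := exist _ (bisim t) (ex_intro _ t erefl).

Definition vmem (x y : zfset) : Prop :=
  exists (A : Type) (f : A -> tree) (a : A),
    y = denote (Sup f) /\ x = denote (f a).

Notation "x ∈ y" := (vmem x y) (at level 70, no associativity).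
Notation "x ∉ y" := (~ vmem x y) (at level 70, no associativity).

(* A class is a [set zfset]; every set is seen as the class of its elements,
   so that [`<=`], [`&`], [\bigcup], [#<=] apply to sets. *)
Definition elts (y : zfset) : set zfset := [set x | x ∈ y].
Coercion elts : zfset >-> set.

Lemma bisim_refl t : bisim t t.
Proof. by elim: t => A f IH /=; split=> a; exists a. Qed.

Lemma bisim_sym s t : bisim s t -> bisim t s.
Proof.
elim: s t => A f IH [B g] /= [h1 h2]; split=> [b|a].
  by have [a /IH] := h2 b; exists a.
by have [b /IH] := h1 a; exists b.
Qed.

Lemma bisim_trans s t u : bisim s t -> bisim t u -> bisim s u.
Proof.
elim: s t u => A f IH [B g] [C h] /= [h1 h2] [k1 k2]; split=> [a|c].
  by have [b ab] := h1 a; have [c bc] := k1 b; exists c; apply: IH bc.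
by have [b bc] := k2 c; have [a ab] := h2 b; exists a; apply: IH bc.
Qed.

Lemma denote_eq s t : denote s = denote t <-> bisim s t.
Proof.
split=> [/(congr1 sval) /= ->|st]; first exact: bisim_refl.
apply: eq_exist => /=; apply/funext => u; apply/propext; split.
  by apply: bisim_trans; apply: bisim_sym.
exact: bisim_trans.
Qed.

Lemma denote_surj (x : zfset) : exists t, x = denote t.
Proof. by case: x => c [t ct]; exists t; apply: eq_exist. Qed.

Definition zf_repr (x : zfset) : tree := sval (cid (denote_surj x)).

Lemma zf_reprK x : denote (zf_repr x) = x.
Proof. by rewrite /zf_repr; case: cid. Qed.

Lemma vmem_denote x A (f : A -> tree) :
  x ∈ denote (Sup f) <-> exists a, x = denote (f a).
Proof.
split=> [[B [g [b [/denote_eq[_ /= /(_ b)[a ab]] ->]]]]|[a ->]]; last first.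
  by exists A, f, a.
by exists a; apply/denote_eq/bisim_sym.
Qed.

Definition family (A : Type) (f : A -> zfset) : zfset :=
  denote (Sup (fun a => zf_repr (f a))).

Lemma familyP A (f : A -> zfset) x : x ∈ family f <-> exists a, x = f a.
Proof. by rewrite vmem_denote; split=> -[a ->]; exists a; rewrite zf_reprK. Qed.

Lemma zf_ext (x y : zfset) : (forall z, z ∈ x <-> z ∈ y) -> x = y.
Proof.
have [[A f] ->] := denote_surj x; have [[B g] ->] := denote_surj y => xy.
apply/denote_eq; split=> [a|b].
  have /vmem_denote[b /denote_eq ab] := (xy (denote (f a))).1
    ((vmem_denote _ _).2 (ex_intro _ a erefl)).
  by exists b.
have /vmem_denote[a /denote_eq/bisim_sym ab] := (xy (denote (g b))).2
  ((vmem_denote _ _).2 (ex_intro _ b erefl)).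
by exists a.
Qed.

Lemma zf_foundation : well_founded vmem.
Proof.
move=> x; have [t ->] := denote_surj x; elim: t => A f IH.
by constructor => y /vmem_denote[a ->].
Qed.

Lemma family_surj (x : zfset) : exists (A : Type) (f : A -> zfset), x = family f.
Proof.
have [[A f] ->] := denote_surj x; exists A, (denote \o f).
by apply: zf_ext => z; rewrite vmem_denote familyP.
Qed.

Lemma zf_empty : exists x : zfset, forall z, z ∉ x.
Proof. by exists (family (fun e : False => match e with end)) => z /familyP[]. Qed.

Lemma zf_pairing (x y : zfset) : exists p : zfset,
  forall z, z ∈ p <-> z = x \/ z = y.
Proof.
exists (family (fun b : bool => if b then x else y)) => z.
rewrite familyP; split=> [[[] ->]|[->|->]]; [by left|by right|..].
  by exists true.
by exists false.
Qed.

Lemma zf_separation (P : set zfset) (x : zfset) : exists y : zfset,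
  forall z, z ∈ y <-> z ∈ x /\ P z.
Proof.
have [A [f ->]] := family_surj x.
exists (family (fun a : {a | P (f a)} => f (sval a))) => z.
rewrite !familyP; split=> [[[a Pa] ->]|[[a ->] Pa]]; first by split=> //; exists a.
by exists (exist _ a Pa).
Qed.

Lemma zf_union (x : zfset) : exists u : zfset,
  forall z, z ∈ u <-> exists2 y, y ∈ x & z ∈ y.
Proof.
have [A [f ->]] := family_surj x.
pose B a := sval (cid (family_surj (f a))).
pose g a : B a -> zfset := sval (cid (svalP (cid (family_surj (f a))))).
have fE a : f a = family (@g a) by exact: (svalP (cid (svalP (cid (family_surj (f a)))))).
exists (family (fun p : {a : A & B a} => g (tag p) (tagged p))) => z.
rewrite familyP; split=> [[[a b] ->]|[y /familyP[a ->]]].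
  by exists (f a); [apply/familyP; exists a|rewrite fE; apply/familyP; exists b].
by rewrite fE => /familyP[b ->]; exists (Tagged B b).
Qed.

Lemma zf_power (x : zfset) : exists p : zfset, forall z : zfset, z ∈ p <-> z `<=` x.
Proof.
have [A [f ->]] := family_surj x.
exists (family (fun P : A -> Prop => family (fun a : {a | P a} => f (sval a)))).
move=> z; rewrite familyP; split=> [[P ->] y /familyP[a ->]|zx].
  by apply/familyP; exists (sval a).
exists (fun a => f a ∈ z); apply: zf_ext => y; rewrite familyP; split=> [yz|].
  have /familyP[a ya] := zx _ yz; rewrite ya in yz *.
  by exists (exist _ a yz).
by move=> [[a /= az] ->].
Qed.

Lemma zf_replacement (F : zfset -> zfset) (x : zfset) : exists y : zfset,
  forall z, z ∈ y <-> exists2 w, w ∈ x & z = F w.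
Proof.
have [A [f ->]] := family_surj x; exists (family (F \o f)) => z.
rewrite familyP; split=> [[a ->]|[w /familyP[a ->] ->]]; last by exists a.
by exists (f a) => //; apply/familyP; exists a.
Qed.

Lemma zf_infinity : exists x : zfset,
  (exists e, e ∈ x /\ forall z, z ∉ e) /\
  (forall y, y ∈ x -> exists y', y' ∈ x /\ forall z, z ∈ y' <-> z ∈ y \/ z = y).
Proof.
have suc (y : zfset) : exists y', forall z, z ∈ y' <-> z ∈ y \/ z = y.
  have [p pP] := zf_pairing y y; have [q qP] := zf_pairing y p.
  have [u uP] := zf_union q; exists u => z; rewrite uP; split=> [[w /qP[->|->]]|].
  - by left.
  - by move=> /pP[]; right.
  - case=> [zy|->]; first by exists y => //; apply/qP; left.
    by exists p; [apply/qP; right|apply/pP; left].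
have [e eP] := zf_empty; have [s sP] := choice suc.
exists (family (fun n => iter n s e)); split.
  by exists e; split=> //; apply/familyP; exists 0.
move=> y /familyP[n ->]; exists (s (iter n s e)); split; last exact: sP.
by apply/familyP; exists n.+1.
Qed.

Lemma zf_choice (x : zfset) : (forall y, y ∈ x -> exists z, z ∈ y) ->
  exists F : zfset -> zfset, forall y, y ∈ x -> F y ∈ y.
Proof.
move=> xP; have /choice[F FP] y : exists z, y ∈ x -> z ∈ y.
  have [yx|nyx] := pselect (y ∈ x); last by exists y.
  by have [z] := xP _ yx; exists z.
by exists F.
Qed.

HB.instance Definition _ := gen_eqMixin zfset.
HB.instance Definition _ := gen_choiceMixin zfset.
HB.instance Definition _ := isPointed.Build zfset (sval (cid zf_empty)).

(* Von Neumann ordinals; membership is well-founded by [zf_foundation]. *)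
Definition is_ord (a : zfset) : Prop :=
  (forall b, b ∈ a -> b `<=` a) /\
  (forall b c, b ∈ a -> c ∈ a -> [\/ b ∈ c, b = c | c ∈ b]).

Definition ord_le (a b : zfset) : Prop := a ∈ b \/ a = b.

Definition is_least_ord (P : set zfset) (a : zfset) : Prop :=
  [/\ is_ord a, P a & forall b, is_ord b -> P b -> ord_le a b].

(* A junk value if no ordinal satisfies [P] (see [least_ordP]); the instances
   [cof] and [succ_card] are justified by [cofP] and [succ_cardP]. *)
Definition least_ord (P : set zfset) : zfset := get (is_least_ord P).

Definition is_limit (a : zfset) : Prop :=
  [/\ is_ord a, exists b, b ∈ a & forall b, b ∈ a -> exists2 c, c ∈ a & b ∈ c].

(* [#<=] and [#=] range over all Rocq functions; between sets these are the
   same as the functions that are sets, by [zf_replacement]. *)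
Definition card_lt (X Y : set zfset) : Prop := X #<= Y /\ ~ (Y #<= X).

Definition is_card (k : zfset) : Prop :=
  is_ord k /\ forall a, a ∈ k -> ~ (a #= k).

Definition succ_card (mu : zfset) : zfset :=
  least_ord [set k | is_card k /\ mu ∈ k].

Definition unbounded_in (X : set zfset) (a : zfset) : Prop :=
  forall b, b ∈ a -> exists2 c, (X `&` a) c & ord_le b c.

(* With [ord_le] in [unbounded_in], cof 0 = 0 and cof (a + 1) = 1. *)
Definition cof (a : zfset) : zfset :=
  least_ord [set g | exists f : zfset -> zfset,
    (forall i, i ∈ g -> f i ∈ a) /\ unbounded_in (f @` g) a].

Definition is_regular (k : zfset) : Prop :=
  [/\ is_card k, infinite_set k & cof k = k].

Definition is_club (D mu : zfset) : Prop :=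
  [/\ D `<=` mu, unbounded_in D mu &
      forall d, d ∈ mu -> is_limit d -> unbounded_in D d -> d ∈ D].

Definition subsets_lt (X : set zfset) (kappa : zfset) : set zfset :=
  [set y : zfset | y `<=` X /\ card_lt y kappa].

Lemma vmem_irr a : a ∉ a.
Proof. by elim: (zf_foundation a) => x _ IH xx; apply: (IH _ xx). Qed.

Lemma vmem_cycle3 a b c : a ∈ b -> b ∈ c -> c ∉ a.
Proof.
elim: (zf_foundation a) b c => x _ IH b c xb bc cx0.
by apply: (IH _ cx0 _ _ cx0 xb bc).
Qed.

Lemma vmem_asym a b : a ∈ b -> b ∉ a.
Proof.
elim: (zf_foundation a) b => x _ IH b xb bx.
by apply: (IH _ bx _ bx xb).
Qed.

Lemma ord_mem a b : is_ord a -> b ∈ a -> is_ord b.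
Proof.
move=> [ta la] ba; split=> [c cb d dc|c d cb db]; last first.
  by apply: la; apply: (ta b).
have ca : c ∈ a by apply: (ta b).
have da : d ∈ a by apply: (ta c).
have [//|db|bd] := la _ _ da ba.
  by rewrite db in dc; case: (vmem_asym cb).
by case: (vmem_cycle3 bd dc).
Qed.

Lemma ord_subset a b : is_ord a -> is_ord b -> a `<=` b -> ord_le a b.
Proof.
move=> oa ob ab; have [->|neq] := pselect (a = b); [by right|left].
have [c [cb ca] cmin] : exists2 c, c ∈ b /\ c ∉ a &
    forall d, d ∈ c -> d ∈ b -> d ∈ a.
  apply: contrapT => noc; apply: neq; apply: zf_ext => z; split=> [/ab//|zb].
  elim: (zf_foundation z) zb => x _ IH xb; apply: contrapT => xa; apply: noc.
  by exists x => // d dx; apply: IH.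
suff -> : a = c by [].
apply: zf_ext => z; split=> [za|zc]; last by apply: cmin => //; apply: ob.1 zc.
have [//|zc|cz] := ob.2 _ _ (ab _ za) cb; first by rewrite zc in za.
by case: ca; apply: oa.1 cz.
Qed.

Lemma ord_total a b : is_ord a -> is_ord b -> [\/ a ∈ b, a = b | b ∈ a].
Proof.
move=> oa ob; have [c cP] := zf_separation b a.
have oc : is_ord c.
  split=> [x /cP[xa xb] y yx|x y /cP[xa _] /cP[ya _]]; last exact: oa.2.
  by apply/cP; split; [apply: oa.1 yx|apply: ob.1 yx].
have [ca|ca] : ord_le c a by apply: ord_subset => // x /cP[].
  have [cb|cb] : ord_le c b by apply: ord_subset => // x /cP[].
    by case: (@vmem_irr c); apply/cP.
  by constructor 3; rewrite -cb.
have [cb|cb] : ord_le c b by apply: ord_subset => // x /cP[].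
  by constructor 1; rewrite -ca.
by constructor 2; rewrite -ca.
Qed.

Lemma least_ordP (P : set zfset) :
  (exists2 a, is_ord a & P a) -> is_least_ord P (least_ord P).
Proof.
move=> [a]; elim: (zf_foundation a) => x _ IH ox Px.
have [[y yx [oy Py]]|no] :=
  pselect (exists2 y, y ∈ x & is_ord y /\ P y); first exact: IH yx oy Py.
apply: getPex; exists x; split=> // b ob Pb.
have [xb|->|bx] := ord_total ox ob; [by left|by right|].
by case: no; exists b.
Qed.

Lemma cofP a : is_ord a -> is_least_ord
  [set g | exists f : zfset -> zfset,
    (forall i, i ∈ g -> f i ∈ a) /\ unbounded_in (f @` g) a] (cof a).
Proof.
move=> oa; apply: least_ordP; exists a => //; exists id; split=> // b ba.
by exists b; [split=> //; exists b|right].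
Qed.

Lemma hartogs (mu : zfset) : exists t : zfset,
  forall a, a ∈ t <-> is_ord a /\ (a #<= mu).
Proof.
have [A [g muE]] := family_surj mu.
pose rk (r : {r : A -> A -> Prop | well_founded r}) : A -> zfset :=
  Fix (svalP r) (fun _ => zfset)
    (fun a rec => family (fun b : {b | sval r b a} => rec (sval b) (svalP b))).
have rkE r a : rk r a = family (fun b : {b | sval r b a} => rk r (sval b)).
  rewrite {1}/rk Fix_eq // => x f h fh; congr family; apply/funext => b.
  exact: fh.
pose F (p : (A -> Prop) * {r : A -> A -> Prop | well_founded r}) :=
  family (fun a : {a | p.1 a} => rk p.2 (sval a)).
have [t tP] := zf_separation [set a | is_ord a /\ (a #<= mu)] (family F).
exists t => a; rewrite tP; split=> [[]//|]; move=> [oa amu]; split=> //.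
have /pcard_leP/injfunPex[f fmu finj] := amu.
have inj x y : x ∈ a -> y ∈ a -> f x = f y -> x = y.
  by move=> xa ya; apply: finj; apply/mem_set.
pose r b c := exists x y, [/\ x ∈ a, y ∈ a, f x = g b, f y = g c & x ∈ y].
have accr x i : x ∈ a -> f x = g i -> Acc r i.
  elim: (zf_foundation x) i => {}x _ IH i xa xi.
  constructor => b [u [v [ua va ub vi uv]]].
  by apply: (IH u) => //; rewrite (inj _ _ xa va) // xi vi.
have wfr : well_founded r.
  move=> i; constructor => b [u [v [ua va ub vi uv]]]; exact: accr ub.
pose R : {r : A -> A -> Prop | well_founded r} := exist _ r wfr.
have rkR x i : x ∈ a -> f x = g i -> rk R i = x.
  elim: (zf_foundation x) i => {}x _ IH i xa xi.
  rewrite rkE; apply: zf_ext => z; rewrite familyP; split=> [[[b rb] ->]|zx] /=.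
    have [u [v [ua va ub vi uv]]] := rb.
    have xv : x = v by apply: inj; rewrite // xi vi.
    by rewrite (IH u) // xv.
  have za : z ∈ a by apply: oa.1 xa _ zx.
  have := fmu _ za; rewrite muE => /familyP[b zb].
  have rb : r b i by exists z, x.
  by exists (exist _ b rb) => /=; rewrite (IH z).
apply/familyP; exists (fun i => exists2 x, x ∈ a & f x = g i, R).
apply: zf_ext => z; rewrite familyP; split=> [za|[[i [x xa xi]] ->]] /=.
  have := fmu _ za; rewrite muE => /familyP[b zb].
  have Pb : exists2 x, x ∈ a & f x = g b by exists z.
  by exists (exist _ b Pb) => /=; rewrite (rkR z).
by rewrite (rkR x).
Qed.

Lemma succ_cardP mu : is_ord mu ->
  is_least_ord [set k | is_card k /\ mu ∈ k] (succ_card mu).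
Proof.
move=> omu; apply: least_ordP; have [t tP] := hartogs mu.
have ot : is_ord t.
  split=> [b /tP[ob bmu] c cb|b c /tP[ob _] /tP[oc _]]; last exact: ord_total.
  apply/tP; split; first exact: ord_mem cb.
  by apply: card_le_trans bmu; apply: subset_card_le; apply: ob.1.
have tmu : ~ (t #<= mu) by move=> tmu; apply: (@vmem_irr t); apply/tP.
have [ol lmu lmin] := @least_ordP [set a | ~ (a #<= mu)] (ex_intro2 _ _ t ot tmu).
set l := least_ord _ in ol lmu lmin.
exists l => //; split; first split=> // b bl /card_eqPle[_ lb].
  have bmu : b #<= mu.
    apply: contrapT => bmu.
    have [lb'|lb'] := lmin _ (ord_mem ol bl) bmu.
      by apply: (@vmem_irr b); apply: (ord_mem ol bl).1 lb' _ bl.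
    by rewrite lb' in bl; exact: vmem_irr bl.
  by apply: lmu; apply: card_le_trans lb bmu.
have [//|ml|lm] := ord_total omu ol; exfalso; apply: lmu.
  by rewrite ml.
by apply: subset_card_le; apply: omu.1.
Qed.

(* Variables are natural numbers; [FAll i p] binds the variable [i]. *)
Inductive formula :=
  | FMem (i j : nat)
  | FEq (i j : nat)
  | FNot (p : formula)
  | FAnd (p q : formula)
  | FAll (i : nat) (p : formula).

Definition update (s : nat -> zfset) (i : nat) (v : zfset) : nat -> zfset :=
  fun j => if j == i then v else s j.

Fixpoint sat (N : set zfset) (s : nat -> zfset) (p : formula) : Prop :=
  match p with
  | FMem i j => s i ∈ s j
  | FEq i j => s i = s j
  | FNot q => ~ sat N s q
  | FAnd q r => sat N s q /\ sat N s r
  | FAll i q => forall v, N v -> sat N (update s i v) q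
  end.

Definition elementary_submodel (M N : set zfset) : Prop :=
  [/\ M !=set0, M `<=` N &
      forall (p : formula) (s : nat -> zfset), (forall i, M (s i)) ->
        (sat M s p <-> sat N s p)].

Definition trcl (x : zfset) : set zfset := [set y | clos_trans zfset vmem y x].

(* Hereditarily of cardinality < chi: the transitive closure has size < chi. *)
Definition hered_lt (chi : zfset) : set zfset := [set x | card_lt (trcl x) chi].

(* A sequence indexed by an ordinal is a function on [zfset] of which only the
   values at members of that ordinal matter. *)
Definition jensen_row (mu : zfset) (M : zfset -> zfset -> zfset) (a : zfset)
  : set zfset := \bigcup_(b in cof mu) M a b.

Record jensen_matrix (kappa mu chi x : zfset) (M : zfset -> zfset -> zfset)
  : Prop := JensenMatrix {
  jensen1 : forall a b, a ∈ succ_card mu -> b ∈ cof mu ->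
    [/\ elementary_submodel (M a b) (hered_lt chi), x ∈ M a b,
        kappa `|` [set kappa] `<=` M a b & card_lt (M a b) mu];
  jensen2 : forall a b b', a ∈ succ_card mu -> b ∈ b' -> b' ∈ cof mu ->
    M a b `<=` M a b';
  jensen3 : forall a, a ∈ succ_card mu -> ord_le kappa (cof a) ->
    exists2 b0, b0 ∈ cof mu &
      forall b, ord_le b0 b -> b ∈ cof mu ->
        forall z, subsets_lt (M a b) kappa z ->
          exists2 y, (subsets_lt (M a b) kappa `&` M a b) y & z `<=` y;
  jensen4 :
    [/\ forall a a', a ∈ a' -> a' ∈ succ_card mu ->
          jensen_row mu M a `<=` jensen_row mu M a',
        forall d, d ∈ succ_card mu -> is_limit d ->
          jensen_row mu M d = \bigcup_(a in d) jensen_row mu M a &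
        succ_card mu `<=` \bigcup_(a in succ_card mu) jensen_row mu M a]
}.

Definition box3 (kappa mu : zfset) : Prop :=
  exists (C : zfset -> zfset) (D : zfset),
    is_club D (succ_card mu) /\
    forall a, a ∈ D -> ord_le kappa (cof a) ->
      [/\ C a `<=` a, unbounded_in (C a) a &
          forall z, subsets_lt (C a) kappa z ->
            exists a', [/\ a' ∈ a, z `<=` C a' & card_lt (C a') kappa]].

(* Main.v *)
(* Write [lam] for the successor of [mu] and [M_a] for the union of the row
   [a].  All rows have size at most [mu], so there is an injection [h] of their
   union into [lam].  Let [D] be the club of the limits [a < lam] such that
   [a] is included in [M_a] and [h] maps [M_a] into [a].  For [a] in [D] of
   cofinality at least [kappa], hence greater than [cof mu], some [M_(a,b)] with
   [b] as in (j3) is unbounded in [a]; take [C_a] to be its trace on [a].  A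
   small subset of [C_a] is covered by a small [y] in [M_(a,b)], and [y] is the
   value of [C] at the successor of [h y], which is below [a] and not in [D]. *)

Require Import Defs.
From Stdlib Require Import Relation_Operators Wellfounded.
From mathcomp Require Import all_boot.
From mathcomp Require Import boolp classical_sets functions cardinality.

Set Implicit Arguments.
Unset Strict Implicit.
Unset Printing Implicit Defensive.

Local Open Scope classical_set_scope.
Local Open Scope card_scope.

(** * Cardinal arithmetic by explicit injections *)

Lemma card_le_injP T (U : pointedType) (A : set T) (B : set U) :
  A #<= B <-> exists2 f : T -> U, (forall x, A x -> B (f x)) &
    forall x y, A x -> A y -> f x = f y -> x = y.
Proof.
split=> [/pcard_leP/injfunPex[f fAB finj]|[f fAB finj]].
  by exists f => // x y Ax Ay; apply: finj; apply/mem_set.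
apply/pcard_leP/injfunPex; exists f => // x y /set_mem Ax /set_mem Ay.
exact: finj.
Qed.

Lemma card_leXX T (U : pointedType) (A : set T) (B : set U) :
  A #<= B -> A `*` A #<= B `*` B.
Proof.
move=> /card_le_injP[f fAB finj]; apply/card_le_injP.
exists (fun p => (f p.1, f p.2)) => [p [p1 p2]|]; first by split; apply: fAB.
by move=> [x y] [x' y'] [/= ? ?] [/= ? ?] [/finj-> // /finj->].
Qed.

Lemma infinite_setU1_le (T : pointedType) (A : set T) x :
  infinite_set A -> A `|` [set x] #<= A.
Proof.
move=> infA; have [Ax|nAx] := pselect (A x).
  by apply: subset_card_le => y [|->].
have /infiniteP/card_le_injP[f fA finj] := infA.
have {}finj : injective f by move=> m n; apply: finj.
(* Hilbert's hotel: [x] goes to [f 0] and [f n] to [f n.+1]. *)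
pose shift n y := (y = x /\ n = 0) \/ exists2 m, y = f m & n = m.+1.
pose g y := if pselect (exists n, shift n y) is left e then f (sval (cid e)) else y.
have xf n : x <> f n by move=> xE; apply: nAx; rewrite xE; apply: fA.
have gE y n : shift n y -> g y = f n.
  move=> yn; rewrite /g; case: pselect => [e|[]]; last by exists n.
  case: (cid e) => k /= yk; congr f.
  case: yn yk => [[-> ->]|[m -> ->]] [[] //|[]].
  - by move=> ? /xf.
  - by move=> /esym /xf.
  - by move=> ? /finj -> ->.
have gN y : (forall n, ~ shift n y) -> g y = y.
  by move=> ny; rewrite /g; case: pselect => // e; have [n /ny] := e.
(* A point of the domain off the shifted sequence is fixed by [g] and is no value of [f], so it
   cannot collide with a shifted point. *)
have inv w : (exists n, shift n w) \/
    (A w \/ w = x -> [/\ A w, forall n, w <> f n & g w = w]).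
  have [|/forallNP nw] := EM (exists n, shift n w); [by left|right].
  move=> [Aw|wx]; last by case: (nw 0); left.
  split=> [//|n wE|]; last exact: gN.
  by apply: (nw n.+1); right; exists n.
apply/card_le_injP; exists g => [y|y z].
  case: (inv y) => [[n yn]|yP] Ay; first by rewrite (gE _ _ yn); apply: fA.
  by have [? _ ->] := yP Ay.
case: (inv y) => [[n yn]|yP]; case: (inv z) => [[m zm]|zP] Ay Az.
- rewrite (gE _ _ yn) (gE _ _ zm) => /finj nm; move: yn zm; rewrite nm.
  by move=> [[-> ->]|[k -> ->]] [[-> e]|[j -> e]] //; case: e => ->.
- by have [_ zf ->] := zP Az; rewrite (gE _ _ yn) => /esym/zf.
- by have [_ yf ->] := yP Ay; rewrite (gE _ _ zm) => /yf.
- by have [_ _ ->] := yP Ay; have [_ _ ->] := zP Az.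
Qed.

Lemma finite_infinite_card_le T U (A : set T) (B : set U) :
  finite_set A -> infinite_set B -> A #<= B.
Proof. by move=> /finite_set_countable + /infiniteP; apply: card_le_trans. Qed.

(* Greedy injection: by recursion along [R], send each [x] to a value in [L]
   not yet taken; one is left because [L] does not inject into the set of
   predecessors of [x]. *)
Lemma greedy_card_le T (U : pointedType) (R : T -> T -> Prop) (X : set T)
    (L : set U) :
  well_founded R ->
  (forall x y, X x -> X y -> [\/ R x y, x = y | R y x]) ->
  (forall x, X x -> ~ (L #<= [set y | X y /\ R y x])) ->
  X #<= L.
Proof.
move=> wfR totR small.
pose fresh x (F : forall y, R y x -> U) : U :=
  xget point [set l | L l /\ forall y (h : R y x), X y -> l <> F y h].
pose f := Fix wfR (fun=> U) fresh.
have fE x : f x = xget point [set l | L l /\ forall y, R y x -> X y -> l <> f y].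
  rewrite /f Fix_eq // => y F G FG; congr fresh.
  by apply: functional_extensionality_dep => z; apply/funext.
have fP x : X x -> L (f x) /\ forall y, R y x -> X y -> f x <> f y.
  move=> Xx; pose P := [set l | L l /\ forall y, R y x -> X y -> l <> f y].
  suff : P (f x) by [].
  rewrite fE; apply: xgetPex; apply: contrapT => full; apply: (small _ Xx).
  apply: card_le_trans (card_image_le f _); apply: subset_card_le => l Ll.
  apply: contrapT => nl; apply: full; exists l; split=> // y yx Xy lE.
  by apply: nl; exists y.
apply/card_le_injP; exists f => [x /fP[]//|x y Xx Xy fxy].
have [xy|//|yx] := totR _ _ Xx Xy.
  by have [_ /(_ _ xy Xx)] := fP _ Xy; rewrite fxy.
by have [_ /(_ _ yx Xy)] := fP _ Xx; rewrite fxy.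
Qed.


(* Well-order the square by the maximum of the coordinates, then
   lexicographically, so that initial segments lie in squares of smaller sets. *)
Lemma ord_card_mul (a : zfset) : is_ord a -> infinite_set a -> a `*` a #<= a.
Proof.
elim: (zf_foundation a) => {}a _ IH oa infa.
(* If [a] injects into one of its members, induction suffices; otherwise [a] is an initial ordinal
   and the well-order is needed. *)
have [[j ja aj]|card_a] := EM (exists2 j, j ∈ a & a #<= j).
  have infj : infinite_set j by move=> finj; apply: infa; apply: card_le_finite finj.
  apply: card_le_trans (card_leXX aj) _.
  apply: card_le_trans (IH _ ja (ord_mem oa ja) infj) _.
  by apply: subset_card_le; apply: oa.1.
pose m (p : zfset * zfset) := if pselect (p.1 ∈ p.2) then p.2 else p.1.
have mP p : p.1 ∈ a -> p.2 ∈ a -> [/\ m p ∈ a, ord_le p.1 (m p) & ord_le p.2 (m p)].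
  move=> p1 p2; rewrite /m; case: pselect => [p12|np12] /=.
    by split=> //; [left|right].
  split=> //; first by right.
  by have [//|->|] := oa.2 _ _ p1 p2; [right|left].
pose R p q := slexprod _ _ vmem (slexprod _ _ vmem vmem) (m p, p) (m q, q).
apply: (@greedy_card_le _ _ R).
- apply: (@wf_inverse_image _ _ _ (fun p => (m p, p))).
  by apply: wf_slexprod; [|apply: wf_slexprod]; exact: zf_foundation.
- move=> [x y] [x' y'] [/= xa ya] [/= xa' ya']; rewrite /R.
  have [ma _ _] := mP (x, y) xa ya; have [ma' _ _] := mP (x', y') xa' ya'.
  have [mm|mm|mm] := oa.2 _ _ ma ma'; [by constructor 1; left| |by constructor 3; left].
  rewrite mm; have [xx|<-|xx] := oa.2 _ _ xa xa'.
  + by constructor 1; right; left.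
  + have [yy|<-|yy] := oa.2 _ _ ya ya'; [constructor 1|by constructor 2|constructor 3];
      by right; right.
  + by constructor 3; right; left.
(* Predecessors of [q] have both coordinates at most its maximum [c], so they lie in the square of
   [B], the successor of [c]. That square is finite or, by induction, injects into [c]; either way
   [a] cannot inject into it. *)
move=> q [qa qb]; have [ca _ _] := mP q qa qb; set c := m q in ca.
set S := [set _ | _]; pose B : set zfset := c `|` [set c].
have SB : S `<=` B `*` B.
  move=> p [[pa pb] pq]; have [_ l1 l2] := mP p pa pb.
  have mc : ord_le (m p) c.
    by inversion pq; [left|right].
  have oc := ord_mem oa ca.
  have le_trans x : ord_le x (m p) -> B x.
    move=> [xm|->]; last by case: mc => [?|->]; [left|right].
    by left; case: mc => [/oc.1|<-]; [apply|].
  by split; apply: le_trans.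
move=> aS; have {}aS : a #<= B `*` B := card_le_trans aS (subset_card_le SB).
have [finc|infc] := EM (finite_set c).
  apply: infa; apply: card_le_finite aS _; apply: finite_setX;
  by rewrite finite_setU; split=> //; apply: finite_set1.
apply: card_a; exists c => //; apply: card_le_trans aS _.
apply: card_le_trans (card_leXX (infinite_setU1_le _ infc)) _.
exact: IH (ord_mem oa ca) infc.
Qed.

(** Each point goes to the code of a chosen index paired with its own code in that set, which
    injects the union into the square of [a]. *)
Lemma card_bigcup_le T I (a : zfset) (D : set I) (F : I -> set T) :
  is_ord a -> infinite_set a -> D #<= a -> (forall i, D i -> F i #<= a) ->
  \bigcup_(i in D) F i #<= a.
Proof.
move=> oa infa /card_le_injP[e eDa einj] Fa.
apply: card_le_trans (ord_card_mul oa infa).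
have /choice[f fP] i : exists g : T -> zfset, D i ->
    (forall t, F i t -> g t ∈ a) /\
    (forall s t, F i s -> F i t -> g s = g t -> s = t).
  have [Di|nDi] := EM (D i); last by exists (fun=> point).
  by have /card_le_injP[g ga ginj] := Fa _ Di; exists g.
(* An option, because [I] may be empty. *)
have /choice[k kP] t : exists k : option I, (\bigcup_(i in D) F i) t ->
    exists2 i, k = Some i & D i /\ F i t.
  have [[i Di Fit]|nt] := EM ((\bigcup_(i in D) F i) t); last by exists None.
  by exists (Some i) => _; exists i.
pose h t : zfset * zfset := if k t is Some i then (e i, f i t) else (point, point).
apply/card_le_injP; exists h => [t /kP[i ki [Di Fit]]|s t].
  by rewrite /h ki; split; [apply: eDa|apply: (fP _ Di).1].
move=> /kP[i ki [Di Fis]] /kP[j kj [Dj Fjt]]; rewrite /h ki kj => -[eij].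
have ij : i = j by apply: einj.
by rewrite -ij in Fjt *; apply: (fP _ Di).2.
Qed.

(** * Order and successors of ordinals *)

Lemma ord_le_trans a b c : is_ord c -> ord_le a b -> ord_le b c -> ord_le a c.
Proof.
move=> oc [ab|->//] [bc|<-]; last by left.
by left; apply: oc.1 bc _ ab.
Qed.

Lemma ord_le_mem_trans a b c : is_ord c -> ord_le a b -> b ∈ c -> a ∈ c.
Proof. by move=> oc [ab bc|->//]; apply: oc.1 bc _ ab. Qed.

Lemma ord_leP a b : is_ord a -> is_ord b -> ~ ord_le a b -> b ∈ a.
Proof.
move=> oa ob nab; have [ab|ab|//] := ord_total oa ob; case: nab; [by left|by right].
Qed.

Lemma ord_le_antisym a b : ord_le a b -> ord_le b a -> a = b.
Proof. by move=> [ab|->//] [/(vmem_asym ab)|->]. Qed.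

Lemma ord_succ a : is_ord a ->
  exists2 s : zfset, is_ord s & forall z, z ∈ s <-> ord_le z a.
Proof.
move=> oa.
suff [s sP] : exists s : zfset, forall z, z ∈ s <-> ord_le z a.
  exists s => //; split=> [x /sP xa y yx|x y /sP xa /sP ya].
    by apply/sP; apply: ord_le_trans xa => //; left.
  have le_ord z : ord_le z a -> is_ord z by move=> [/(ord_mem oa)|->].
  by apply: ord_total; apply: le_ord.
have [p pP] := zf_pairing a a; have [q qP] := zf_pairing a p.
have [u uP] := zf_union q; exists u => z; rewrite uP.
split=> [[w /qP[->|->]]|[za|->]]; first by left.
- by move=> /pP[]; right.
- by exists a => //; apply/qP; left.
- by exists p; [apply/qP; right|apply/pP; left].
Qed.

(** * The successor cardinal: size, regularity, clubs *)

Section SuccCard.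
Variable mu : zfset.
Hypotheses (mu_card : is_card mu) (mu_inf : infinite_set mu).
Let lam := succ_card mu.
Let omu : is_ord mu := mu_card.1.

Lemma succ_card_ord : is_ord lam.
Proof. by have [] := succ_cardP omu. Qed.

Lemma succ_card_not_le : ~ (lam #<= mu).
Proof.
have [olam [[_ lcard] mulam] _] := succ_cardP omu => lmu.
apply: (lcard _ mulam); rewrite card_eq_le lmu andbT.
by apply: subset_card_le; apply: olam.1.
Qed.

(** By induction, [a] may be assumed equinumerous with none of its members. It is then a cardinal,
    and the minimality of [lam] keeps it from exceeding [mu]. *)
Lemma mem_succ_card a : a ∈ lam -> a #<= mu.
Proof.
have [olam [_ mulam] lmin] := succ_cardP omu.
elim: (zf_foundation a) => {}a _ IH al; have oa := ord_mem olam al.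
have [[c ca cE]|nc] := EM (exists2 c, c ∈ a & c #= a).
  have := IH _ ca (olam.1 _ al _ ca); apply: card_le_trans.
  by move: cE; rewrite card_eq_le => /andP[].
have [am|->|ma] := ord_total oa omu.
- by apply: subset_card_le; apply: omu.1.
- exact: card_lexx.
have acard : is_card a by split=> // c ca cE; apply: nc; exists c.
have [/(vmem_asym al)//|la] := lmin _ oa (conj acard ma).
by case: (@vmem_irr a); rewrite -{2}la.
Qed.

Lemma card_le_mem_succ_card a : is_ord a -> a #<= mu -> a ∈ lam.
Proof.
move=> oa amu; apply: ord_leP => //; first exact: succ_card_ord.
move=> la; apply: succ_card_not_le; apply: card_le_trans amu.
apply: subset_card_le; case: la => [/oa.1|->]//.
Qed.

(** Regularity of [lam]: the ordinals at most some [f x] form an ordinal that is a union of at most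
    [mu] sets of size at most [mu], hence a member of [lam]. *)
Lemma succ_card_bound T (X : set T) (f : T -> zfset) :
  X #<= mu -> (forall x, X x -> f x ∈ lam) ->
  exists2 b, b ∈ lam & forall x, X x -> f x ∈ b.
Proof.
move=> Xmu fX; have olam := succ_card_ord.
have [u uP] := zf_separation (\bigcup_(x in X) [set z | ord_le z (f x)]) lam.
have uE z : z ∈ u <-> exists2 x, X x & ord_le z (f x).
  rewrite uP; split=> [[]//|[x Xx zx]]; split; last by exists x.
  exact: ord_le_mem_trans zx (fX _ Xx).
exists u; last by move=> x Xx; apply/uE; exists x => //; right.
apply: card_le_mem_succ_card.
  split=> [b /uE[x Xx bx] c cb|b c /uP[bl _] /uP[cl _]]; last exact: olam.2.
  apply/uE; exists x => //; apply: ord_le_trans bx; last by left.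
  exact: ord_mem olam (fX _ Xx).
have -> : elts u = \bigcup_(x in X) [set z | ord_le z (f x)].
  by apply/seteqP; split=> z; rewrite /elts /= uE.
apply: card_bigcup_le => // x Xx.
have -> : [set z | ord_le z (f x)] = f x `|` [set f x] by [].
have [finf|inff] := EM (finite_set (f x)).
  by apply: finite_infinite_card_le => //; rewrite finite_setU.
exact: card_le_trans (infinite_setU1_le _ inff) (mem_succ_card (fX _ Xx)).
Qed.


Lemma succ_card_bound2 b c : b ∈ lam -> c ∈ lam ->
  exists d, [/\ d ∈ lam, b ∈ d & c ∈ d].
Proof.
move=> bl cl; have [|x [->|->]|d dl dP] := @succ_card_bound _ [set b; c] id => //.
  by apply: finite_infinite_card_le => //; apply: finite_set2.
by exists d; split=> //; apply: dP; [left|right].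
Qed.

(** Closure under [f] passes to limits. For unboundedness, take countably many steps above [b], each
    catching the values of [f] below the previous one; their union is closed under [f]. *)
Lemma closed_points_club (f : zfset -> zfset) (D : zfset) :
  (forall a, a ∈ lam -> f a ∈ lam) ->
  (forall a, a ∈ D <-> [/\ a ∈ lam, is_limit a & forall b, b ∈ a -> f b ∈ a]) ->
  is_club D lam.
Proof.
move=> flam DP; have olam := succ_card_ord.
split=> [a /DP[]//|b bl|d dl limd unbd]; last first.
  apply/DP; split=> // b bd; have [od _ dnext] := limd.
  have [b' b'd bb'] := dnext _ bd; have [c [/DP[_ [oc _ _] fc] cd] b'c] := unbd _ b'd.
  apply: od.1 cd _ _; apply: fc; case: b'c => [/oc.1|<-//]; exact.
have /choice[next nextP] c : exists c', c ∈ lam ->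
    [/\ c' ∈ lam, c ∈ c' & forall x, x ∈ c -> f x ∈ c'].
  have [cl|//] := EM (c ∈ lam); last by exists c.
  have [x /(olam.1 _ cl)/flam//|c1 c1l c1P] := succ_card_bound (f := f) (mem_succ_card cl).
  have [c2 [c2l cc2 c12]] := succ_card_bound2 cl c1l.
  exists c2 => _; split=> // x xc.
  by apply: (ord_mem olam c2l).1 c12 _ _; apply: c1P.
pose s n := iter n next b.
have sl n : s n ∈ lam by elim: n => //= n /nextP[].
have [sS fs] : (forall n, s n ∈ s n.+1) /\ (forall n x, x ∈ s n -> f x ∈ s n.+1).
  by split=> n; have [_ ? ?] := nextP _ (sl n).
(* As [mu] is infinite, the countable sequence [s] has a bound in [lam], so its supremum [u] is in
   [lam] too. *)
have [|//|top topl topP] := @succ_card_bound _ [set: nat] s; first exact/infiniteP.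
have [u uP] := zf_separation (\bigcup_n s n) top.
have otop := ord_mem olam topl.
have uE z : z ∈ u <-> exists n, z ∈ s n.
  rewrite uP; split=> [[_ [n _ ?]]|[n zn]]; first by exists n.
  by split; [apply: otop.1 (topP n I) _ zn|exists n].
have ou : is_ord u.
  split=> [x /uE[n xn] y yx|x y /uP[xt _] /uP[yt _]]; last exact: otop.2.
  by apply/uE; exists n; apply: (ord_mem olam (sl n)).1 xn _ yx.
have su n : s n ∈ u by apply/uE; exists n.+1.
exists u; last by left; apply: (su 0).
have ul : u ∈ lam.
  by apply: ord_le_mem_trans topl => //; apply: ord_subset => // x /uP[].
split=> //; apply/DP; split=> //.
  split=> //; first by exists b; apply: (su 0).
  by move=> x /uE[n xn]; exists (s n).
by move=> x /uE[n /fs ?]; apply/uE; exists n.+1.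
Qed.

End SuccCard.

(** * Increasing covers shorter than the cofinality *)

(** Otherwise each [N b] with [b] at least [b0] has its trace on [a] bounded by some [f b] in [a].
    Since these [N b] already cover [a], the bounds are cofinal in [a], which is impossible with an
    index set below [cof a]. *)
Lemma unbounded_in_increasing_cover (a g b0 : zfset) (N : zfset -> set zfset) :
  is_limit a -> is_ord g -> g ∈ cof a -> b0 ∈ g ->
  (forall b c, b ∈ c -> c ∈ g -> N b `<=` N c) ->
  a `<=` \bigcup_(b in g) N b ->
  exists b, [/\ b ∈ g, ord_le b0 b & unbounded_in (N b) a].
Proof.
move=> [oa [e ea] _] og gcof b0g incr cover; apply: contrapT => nb.
have /choice[f fP] b : exists f, f ∈ a /\
    (b ∈ g -> ord_le b0 b -> forall c, N b c -> c ∈ a -> c ∈ f).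
  have [[bg b0b]|nbg] := EM (b ∈ g /\ ord_le b0 b); last first.
    by exists e; split=> // bg b0b; case: nbg.
  apply: contrapT => nf; apply: nb; exists b; split=> // x xa.
  apply: contrapT => nx; apply: nf; exists x; split=> // _ _ c Nc ca.
  apply: ord_leP (ord_mem oa ca) _; first exact: ord_mem xa.
  by move=> xc; apply: nx; exists c.
have [_ _ cofmin] := cofP oa.
have [||gc] := cofmin g og.
- exists f; split=> [i _|x xa]; first exact: (fP i).1.
  have [b bg Nb] := cover _ xa.
  have [c [cg b0c Nc]] : exists c, [/\ c ∈ g, ord_le b0 c & N c x].
    have [b0b|] := EM (ord_le b0 b); first by exists b.
    move=> /(ord_leP (ord_mem og b0g) (ord_mem og bg)) bb0.
    by exists b0; split=> //; [right|apply: incr Nb].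
  exists (f c); first by split; [exists c|apply: (fP c).1].
  by left; apply: (fP c).2.
- by move=> /(vmem_asym gcof).
- by rewrite gc in gcof; case: (vmem_irr gcof).
Qed.

(** * From the matrix to the sequence *)

Theorem theorem2p5 (kappa mu : zfset)
  (kappa_regular : is_regular kappa)
  (mu_card : is_card mu)
  (kappa_lt_mu : kappa ∈ mu)
  (cof_mu_lt_kappa : cof mu ∈ kappa)
  (has_matrix : exists chi x : zfset,
     [/\ is_card chi, succ_card mu ∈ chi, hered_lt chi x &
         exists M : zfset -> zfset -> zfset, jensen_matrix kappa mu chi x M]) :
  box3 kappa mu.
Proof.
have [chi [x0 [_ _ _ [M [j1 j2 j3 [row_incr row_cont row_cover]]]]]] := has_matrix.
have omu := mu_card.1; have kappa_mu := omu.1 _ kappa_lt_mu.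
have [_ kappa_inf _] := kappa_regular.
have mu_inf : infinite_set mu by apply: sub_infinite_set kappa_inf.
set lam := succ_card mu in j1 j2 j3 row_incr row_cont row_cover *.
have olam : is_ord lam := succ_card_ord mu_card.
have [_ [_ mulam] _] : is_least_ord _ lam := succ_cardP omu.
set row := jensen_row mu M in row_incr row_cont row_cover.
have row_card a : a ∈ lam -> row a #<= mu.
  move=> al; apply: card_bigcup_le => // [|b bmu].
    by apply: subset_card_le; apply: omu.1; apply: kappa_mu.
  by have [_ _ _ []] := j1 _ _ al bmu.
pose Minf := \bigcup_(a in lam) row a.
have [h hlam hinj] : exists2 h : zfset -> zfset, (forall y, Minf y -> h y ∈ lam) &
    forall y z, Minf y -> Minf z -> h y = h z -> y = z.
  apply: (card_le_injP Minf lam).1; have mu_lam := olam.1 _ mulam.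
  apply: card_bigcup_le => // [|a al]; first exact: sub_infinite_set mu_inf.
  exact: card_le_trans (row_card _ al) (subset_card_le mu_lam).
(* [f b] bounds the codes of row [b] and exceeds the index of some row containing [b]; a limit
   closed under [f] thus has both properties wanted of members of [D]. *)
have /choice[f fP] b : exists c, b ∈ lam -> [/\ c ∈ lam,
    forall y, row b y -> h y ∈ c & exists2 e, e ∈ c & row e b].
  have [bl|] := EM (b ∈ lam); last by exists b.
  have [e el eb] := row_cover _ bl.
  have [y yb|c cl cP] := succ_card_bound mu_card mu_inf (f := h) (row_card _ bl).
    by apply: hlam; exists b.
  have [d [dl ed cd]] := succ_card_bound2 mu_card mu_inf el cl.
  exists d => _; split=> //; last by exists e.
  by move=> y /cP yc; apply: (ord_mem olam dl).1 cd _ yc.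
have [D DP] := zf_separation
  [set a | is_limit a /\ forall b, b ∈ a -> f b ∈ a] lam.
have club : is_club D lam.
  apply: (closed_points_club mu_card mu_inf (f := f)) => [a /fP[]//|a].
  by rewrite DP; split=> [[? []]|[]].
(* Continuity at the limit [a] puts [y] in an earlier row [b], and [f b] bounds [h y] below [a]. *)
have D_row a : a ∈ D -> forall y, row a y -> Minf y /\ h y ∈ a.
  move=> /DP[al [lima fa]] y; rewrite row_cont // => -[b ba yb].
  have bl := olam.1 _ al _ ba; split; first by exists b.
  have [_ /(_ _ yb) hy _] := fP _ bl.
  by have [oa _ _] := lima; apply: oa.1 (fa _ ba) _ hy.
have D_sub a : a ∈ D -> a `<=` row a.
  move=> /DP[al [lima fa]] b ba; have [_ _ [e ef eb]] := fP _ (olam.1 _ al _ ba).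
  have [oa _ _] := lima.
  by apply: row_incr eb => //; apply: oa.1 (fa _ ba) _ ef.
(* Small sets are covered here by an element of [row a] instead of a value of [C], so that [c] can
   be found before [C] is defined. *)
pose good (a c : zfset) := [/\ c `<=` a, unbounded_in c a & forall z,
  subsets_lt c kappa z -> exists y, [/\ row a y, z `<=` y & card_lt y kappa]].
have good_ex a : a ∈ D -> ord_le kappa (cof a) -> exists c, good a c.
  move=> aD kcof; have /DP[al [lima _]] := aD; have [oa _ _] := lima.
  have [b0 b0mu b0P] := j3 _ al kcof.
  have [ocofa _ _] := cofP oa; have [ocofmu _ _] := cofP omu.
  have mucof : cof mu ∈ cof a by case: kcof => [/ocofa.1|<-//]; exact.
  have [b [bmu b0b unb]] := unbounded_in_increasing_cover (N := M a) lima ocofmu mucof b0mu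
    (fun b c => j2 a b c al) (D_sub _ aD).
  have [c cP] := zf_separation (M a b) a.
  exists c; split=> [z /cP[]//|z za|z [zc zk]].
    by have [w [Mw wa] zw] := unb _ za; exists w => //; split=> //; apply/cP.
  have [|y [[yM yk] My] zy] := b0P _ b0b bmu z; first by split=> // w /zc/cP[].
  by exists y; split=> //; exists b.
(* [a] is the ordinal successor of the code of [y]; injectivity of [h] leaves at most one such
   [y]. *)
pose succ_of a y := Minf y /\ forall z, z ∈ a <-> ord_le z (h y).
(* The two demands never meet: a member of [D] is a limit, while [succ_of] makes [a] a successor.
   Where neither applies, the value [a] is arbitrary. *)
have /choice[C CP] a : exists c, (a ∈ D -> ord_le kappa (cof a) -> good a c) /\
    (forall y, succ_of a y -> c = y).
  have [[y [My ay]]|ns] := EM (exists y, succ_of a y).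
    exists y; split=> [/DP[_ [[oa _ next] _]] _|z [Mz az]].
      have [c /ay [cy|->] yc] := next (h y) ((ay _).2 (or_intror erefl)).
        by case: (vmem_asym cy).
      by case: (vmem_irr yc).
    by apply: hinj => //; apply: ord_le_antisym; [apply/az/ay|apply/ay/az]; right.
  have [[aD kcof]|nD] := EM (a ∈ D /\ ord_le kappa (cof a)).
    have [c cP] := good_ex _ aD kcof; exists c; split=> // y ya.
    by case: ns; exists y.
  exists a; split=> [aD kcof|y ya]; first by case: nD.
  by case: ns; exists y.
exists C, D; split=> // a aD kcof; have [/(_ aD kcof)[Ca unb cov] _] := CP a.
split=> // z /cov[y [ay zy yk]]; have [My hya] := D_row _ aD _ ay.
have /DP[al [[oa _ next] _]] := aD.
(* [s] is the successor of [h y], so [C] takes the value [y] there. As [a] is a limit, some [t] in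
   [a] lies above [h y], and [s] is at most [t]. *)
have [s os sP] := ord_succ (ord_mem oa hya); have sC : C s = y by apply: (CP s).2.
exists s; rewrite sC; split=> //; have [t ta ht] := next _ hya.
have ot := ord_mem oa ta.
apply: ord_le_mem_trans ta => //; apply: ord_subset => //.
by move=> w /sP wh; apply: ord_le_mem_trans ht.
Qed.
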